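(* Let $K$ be a field, let $I\subset R=K[x_i : x_i\in\mathrm{supp}(I)]$ be a nearly normally torsion-free monomial ideal, let $\mathfrak{m}=(x_i : x_i\in\mathrm{supp}(I))$, and suppose that there exist a monomial prime ideal $\mathfrak{p}\notin \mathrm{Min}(I)$ and an integer $m\geq 1$ such that the following statements hold: (i) $\mathrm{Ass}(R/I^t)=\mathrm{Min}(I)$ for all $1\leq t\leq m$; (ii) $\mathrm{Ass}(R/I^t)\subseteq \mathrm{Min}(I)\cup\{\mathfrak{p}\}$ for all $t\geq m+1$; (iii) for any monomial prime ideal $\mathfrak{P}\subsetneq\mathfrak{m}$ with $\mathfrak{P}\notin\mathrm{Min}(I)$, $I_{\mathfrak{P}}$ is normally torsion-free, where $I_{\mathfrak{P}}$ denotes the localization of $I$ at $\mathfrak{P}$. If there exists some $s\geq m+1$ such that $\mathfrak{p}\in \mathrm{Ass}(R/I^s)$, then $\mathfrak{p}=\mathfrak{m}$.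
   Context: For a monomial ideal $I$ with unique minimal set of monomial generators $\mathcal{G}(I)$, $\mathrm{supp}(I)$ is the set of variables dividing at least one element of $\mathcal{G}(I)$; thus $R$ is the polynomial ring over $K$ in exactly the variables occurring in the minimal generators of $I$. $\mathrm{Min}(I)$ is the set of minimal primes of $I$, and $\mathrm{Ass}(R/Q)$ is the set of associated primes of an ideal $Q$, i.e. the prime ideals of the form $(Q:f)=\{r\in R\mid rf\in Q\}$ with $f\in R$. A monomial prime ideal is an ideal generated by a subset of the variables. A monomial ideal $I$ in a polynomial ring $R$ over a field is called nearly normally torsion-free if there exist a positive integer $k$ and a monomial prime ideal $\mathfrak{q}$ such that $\mathrm{Ass}(R/I^m)=\mathrm{Min}(I)$ for all $1\leq m\leq k$, and $\mathrm{Ass}(R/I^m)\subseteq \mathrm{Min}(I)\cup\{\mathfrak{q}\}$ for all $m\geq k+1$. An ideal $Q$ in a commutative Noetherian ring $S$ is called normally torsion-free if $\mathrm{Ass}_S(S/Q^k)\subseteq \mathrm{Ass}_S(S/Q)$ for all $k\geq 1$ (the unit ideal is trivially normally torsion-free). $I_{\mathfrak{P}}$ is the ideal $IR_{\mathfrak{P}}$ of $R_{\mathfrak{P}}$. *)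

(* Defs.v *)
From HB Require Import structures.
From mathcomp Require Import all_boot all_order all_algebra.
From mathcomp Require Import boolp classical_sets.
From mathcomp Require Import mpoly.

Set Implicit Arguments.
Unset Strict Implicit.
Unset Printing Implicit Defensive.

Import GRing.Theory.

Local Open Scope ring_scope.
Local Open Scope classical_set_scope.

(* Ideals are Prop-valued sets [set R], and may be the unit ideal.  (The
   predicates [idealr] and [prime_idealr] of MathComp's ring_quotient are
   boolean, and [idealr] is moreover always proper.) *)
Section Ideals.
Variable R : comNzRingType.
Implicit Types (I J P Q A : set R) (k : nat).

Definition is_ideal I : Prop :=
  [/\ I 0, forall u v, I u -> I v -> I (u + v) & forall a u, I u -> I (a * u)].

Definition prime_ideal P : Prop :=
  [/\ is_ideal P, ~ P 1 & forall u v, P (u * v) -> P u \/ P v].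

Definition ideal_gen A : set R := smallest is_ideal A.

Definition ideal_mul I J : set R :=
  ideal_gen [set z | exists u v, [/\ I u, J v & z = u * v]].

Definition ideal_exp I k : set R := iter k (ideal_mul I) setT.

Definition colon Q (f : R) : set R := [set r | Q (r * f)].

(* [Ass Q] is Ass(R/Q) *)
Definition Ass Q : set (set R) :=
  [set P | prime_ideal P /\ exists f : R, P = colon Q f].

Definition Min I : set (set R) :=
  [set P | [/\ prime_ideal P, I `<=` P &
     forall P', prime_ideal P' -> I `<=` P' -> P' `<=` P -> P' = P]].

Definition normally_torsion_free Q : Prop :=
  forall k, (1 <= k)%N -> Ass (ideal_exp Q k) `<=` Ass Q.

Lemma is_ideal_gen A : is_ideal (ideal_gen A).
Proof.
split=> [J [[]]//|u v hu hv J|a u hu J] hJ; have [[_ hD hM] _] := hJ.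
  by apply: hD; [apply: hu | apply: hv].
by apply: hM; apply: hu.
Qed.

End Ideals.

(* The localization R_P of a domain R at a prime ideal P, as the subring
   { a / b | b \notin P } of the fraction field of R. *)
Section Localization.
Variables (R : idomainType) (P : set R) (hP : prime_ideal P).

Definition in_localization of prime_ideal P : {pred {fraction R}} :=
  fun x => `[< exists a b : R, ~ P b /\ x = tofrac a / tofrac b >].

Lemma in_localizationP x :
  reflect (exists a b : R, ~ P b /\ x = tofrac a / tofrac b)
          (x \in in_localization hP).
Proof. exact: asboolP. Qed.

Lemma tofrac_notin_prime_neq0 (b : R) : ~ P b -> tofrac b != 0.
Proof.
move=> nPb; rewrite tofrac_eq0; apply/eqP => b0.
by apply: nPb; rewrite b0; case: hP => -[].
Qed.

Lemma notin_primeM (b d : R) : ~ P b -> ~ P d -> ~ P (b * d).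
Proof. by case: hP => _ _ hM nb nd /hM[]. Qed.

Lemma in_localization_subring : subring_closed (in_localization hP).
Proof.
split=> [|x y /in_localizationP[a [b [nb ->]]] /in_localizationP[c [d [nd ->]]]
         |x y /in_localizationP[a [b [nb ->]]] /in_localizationP[c [d [nd ->]]]];
  apply/in_localizationP.
- by exists 1, 1; case: hP => _ n1 _; rewrite tofrac1 divr1.
- exists (a * d - c * b), (b * d); split; first exact: notin_primeM.
  rewrite -mulNr addf_div ?tofrac_notin_prime_neq0 // mulNr.
  by rewrite [in RHS]rmorphB /= !tofracM.
- exists (a * c), (b * d); split; first exact: notin_primeM.
  by rewrite mulf_div !tofracM.
Qed.

HB.instance Definition _ :=
  GRing.isSubringClosed.Build _ (in_localization hP) in_localization_subring.

Record localization := Localization {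
  localization_val : {fraction R};
  localization_valP : localization_val \in in_localization hP }.

HB.instance Definition _ := [isSub for localization_val].
HB.instance Definition _ := [Choice of localization by <:].
HB.instance Definition _ := [SubChoice_isSubComNzRing of localization by <:].

Lemma tofrac_in_localization (a : R) : tofrac a \in in_localization hP.
Proof.
apply/in_localizationP; exists a, 1.
by case: hP => _ n1 _; rewrite tofrac1 divr1.
Qed.

Definition to_localization (a : R) : localization :=
  Localization (tofrac_in_localization a).

Lemma to_localization_is_zmod_morphism : zmod_morphism to_localization.
Proof. by move=> a b; apply: val_inj; exact: tofracB. Qed.

HB.instance Definition _ := GRing.isZmodMorphism.Build R localization
  to_localization to_localization_is_zmod_morphism.

Lemma to_localization_is_monoid_morphism : monoid_morphism to_localization.
Proof.
by split=> [|a b]; apply: val_inj; [exact: tofrac1 | exact: tofracM].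
Qed.

HB.instance Definition _ := GRing.isMonoidMorphism.Build R localization
  to_localization to_localization_is_monoid_morphism.

Definition localize_ideal (I : set R) : set localization :=
  ideal_gen (to_localization @` I).

End Localization.

Arguments localize_ideal {R P} hP I _.

Section MonomialIdeals.
Variables (K : fieldType) (n : nat).
Local Notation R := {mpoly K[n]}.
Implicit Types (I P : set R) (G : set 'X_{1..n}) (V : set 'I_n).

(* A set of monomials is given by the set of its exponent vectors. *)
Definition ideal_of_monomials G : set R := ideal_gen [set 'X_[g] | g in G].

Definition monomial_ideal I : Prop := exists G, I = ideal_of_monomials G.

Definition minimal_monomial_generators I G : Prop :=
  I = ideal_of_monomials G /\
  forall G', G' `<=` G -> I = ideal_of_monomials G' -> G' = G.

(* The minimal set of monomial generators of a monomial ideal exists and is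
   unique, so the [exists2] below selects it. *)
Definition supp I : set 'I_n :=
  [set i | exists2 G, minimal_monomial_generators I G &
             exists2 g, G g & (U_(i) <= g)%MM].

Definition ideal_of_vars V : set R := ideal_gen [set 'X_i | i in V].

Definition monomial_prime_ideal P : Prop := exists V, P = ideal_of_vars V.

Definition nearly_normally_torsion_free I : Prop :=
  monomial_ideal I /\
  exists k (q : set R),
    [/\ (1 <= k)%N, monomial_prime_ideal q,
        forall m, (1 <= m <= k)%N -> Ass (ideal_exp I m) = Min I &
        forall m, (k + 1 <= m)%N -> Ass (ideal_exp I m) `<=` Min I `|` [set q]].

Lemma monomial_prime_ideal_prime P : monomial_prime_ideal P -> prime_ideal P.
Proof.
case=> V ->; have [J0 JD JM] := is_ideal_gen [set ('X_i : R) | i in V].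
pose t : n.-tuple R := [tuple if `[< V i >] then 0 else 'X_i | i < n].
pose phi (f : R) := f \mPo t.
have phiM f g : phi (f * g) = phi f * phi g by rewrite /phi rmorphM.
have JN f : ideal_of_vars V f -> ideal_of_vars V (- f).
  by move=> /(JM (-1)); rewrite mulN1r.
have phiX i : phi 'X_i = if `[< V i >] then 0 else 'X_i.
  by rewrite /phi comp_mpolyXU -tnth_nth tnth_mktuple.
have ker f : ideal_of_vars V f -> phi f = 0.
  move=> hf; apply: (hf [set g | phi g = 0]).
  split; last by move=> _ [i Vi <-]; rewrite /= phiX asboolT.
  split=> [|u v|a u]; rewrite /phi /=; first exact: rmorph0.
    by rewrite rmorphD /= => -> ->; rewrite addr0.
  by rewrite rmorphM /= => ->; rewrite mulr0.
pose D f := ideal_of_vars V (f - phi f).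
have DM f g : D f -> D g -> D (f * g).
  move=> Df Dg; rewrite /D phiM.
  have -> : f * g - phi f * phi g = f * (g - phi g) + phi g * (f - phi f).
    by rewrite !mulrBr [phi g * f]mulrC [phi g * _]mulrC addrA subrK.
  by apply: JD; apply: JM.
have DD f g : D f -> D g -> D (f + g).
  by move=> Df Dg; rewrite /D /phi rmorphD /= opprD addrACA; apply: JD.
have DC c : D c%:MP by rewrite /D /phi comp_mpolyC subrr.
have DX i : D 'X_i.
  rewrite /D phiX; case: asboolP => Vi; last by rewrite subrr.
  by rewrite subr0 => B [_]; apply; exists i.
have DXm (m : 'X_{1..n}) : D 'X_[m].
  rewrite mpolyXE_id; apply: (big_ind D) => [|//|i _]; first exact: DC.
  by elim: (m i) => [|e IH]; [exact: DC | rewrite exprS; apply: DM].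
have Dall f : D f.
  rewrite [f]mpolyE; apply: (big_ind D) => [|//|m _].
    by rewrite -mpolyC0; apply: DC.
  by rewrite -mul_mpolyC; apply: DM.
have inJ f : phi f = 0 -> ideal_of_vars V f.
  by move=> f0; have := Dall f; rewrite /D f0 subr0.
split=> [|/ker|u v /ker]; first exact: is_ideal_gen.
  by rewrite /phi rmorph1 => /eqP; rewrite oner_eq0.
rewrite phiM => /eqP; rewrite mulf_eq0 => /orP[] /eqP /inJ; by [left | right].
Qed.

End MonomialIdeals.

(* Main.v *)
Require Import Defs.
From mathcomp Require Import all_boot all_order all_algebra.
From mathcomp Require Import boolp classical_sets.
From mathcomp Require Import mpoly.

(** Associated primes behave well under localization. For a prime [P] of a
    domain [R] and an ideal [Q], extension to [R_P] turns an equality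
    [P = (Q : f)] into [P R_P = (Q R_P : f/1)] ([Ass_localize]). In the other
    direction, an equality [P R_P = (Q R_P : f/b)] gives, for each [a] in [P],
    a denominator outside [P] which sends [a f] into [Q]. If [P] is finitely
    generated, one denominator [c] serves for all of [P], and [P = (Q : c f)]
    ([Ass_delocalize]). Extension also commutes with powers
    ([localize_ideal_exp]).

    The theorem follows. Suppose that [p] is not the ideal generated by all the
    variables. As a monomial prime it is then strictly contained in that ideal,
    and since it is not minimal over [I], the localization [I_p] is normally
    torsion-free. From [p] in [Ass(R/I^s)] it follows that [p R_p] lies in
    [Ass(R_p/I_p^s)], hence in [Ass(R_p/I_p)]. As [p] is generated by finitely
    many variables, [p] itself lies in [Ass(R/I) = Min(I)], a contradiction. *)

Set Implicit Arguments.
Unset Strict Implicit.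
Unset Printing Implicit Defensive.

Import GRing.Theory.

Local Open Scope ring_scope.
Local Open Scope classical_set_scope.

(** * Ideals and colon ideals *)

Section Ideals.
Variable R : comNzRingType.
Implicit Types (I J Q A : set R).

Lemma ideal_gen_min A J : is_ideal J -> A `<=` J -> ideal_gen A `<=` J.
Proof. by move=> hJ AJ x; apply. Qed.

Lemma sub_ideal_gen A : A `<=` ideal_gen A.
Proof. by move=> x Ax J [_]; apply. Qed.

Lemma ideal_mul_mem I J u v : I u -> J v -> ideal_mul I J (u * v).
Proof. by move=> Iu Jv; apply: sub_ideal_gen; exists u, v. Qed.

Lemma is_ideal_setT : is_ideal (setT : set R).
Proof. by []. Qed.

Lemma is_ideal_exp I k : is_ideal (ideal_exp I k).
Proof. by case: k => [|k]; [exact: is_ideal_setT | exact: is_ideal_gen]. Qed.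

Lemma ideal_exp1 I : is_ideal I -> ideal_exp I 1 = I.
Proof.
move=> hI; apply/seteqP; split=> [|x Ix] /=.
  apply: ideal_gen_min => // _ [u [v [Iu _ ->]]].
  by case: hI => _ _ IM; rewrite mulrC; apply: IM.
by rewrite -[x]mulr1; apply: ideal_mul_mem.
Qed.

Lemma is_ideal_colon Q f : is_ideal Q -> is_ideal (colon Q f).
Proof.
move=> [Q0 QD QM]; split; rewrite /colon /=.
- by rewrite mul0r.
- by move=> u v Qu Qv; rewrite mulrDl; apply: QD.
- by move=> a u Qu; rewrite -mulrA; apply: QM.
Qed.

(** A finite product of denominators avoids a prime, which is why finite
    generation lets one element clear all of them. *)
Lemma common_denominator (P Q : set R) (s : seq R) :
    prime_ideal P -> is_ideal Q ->
    (forall a, a \in s -> exists c, ~ P c /\ Q (c * a)) ->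
  exists c, ~ P c /\ forall a, a \in s -> Q (c * a).
Proof.
move=> [_ nP1 PM] [_ _ QM]; elim: s => [|x s IHs] hs; first by exists 1.
have [a sa|c [nPc Qc]] := IHs; first by apply: hs; rewrite inE sa orbT.
have [d [nPd Qd]] := hs x (mem_head x s).
exists (c * d); split=> [/PM[]//|a].
rewrite inE => /orP[/eqP ->|sa]; first by rewrite -mulrA; apply: QM.
by rewrite mulrAC mulrC; apply: QM; apply: Qc.
Qed.

End Ideals.

(** * Extension of ideals to a localization *)

Section Localization.
Variables (R : idomainType) (P : set R) (hP : prime_ideal P).
Implicit Types (I J Q : set R) (a b c : R) (y : localization hP).
Local Notation loc := (to_localization hP).

Lemma to_localization_inj : injective loc.
Proof. by move=> a b /(congr1 val) /= /eqP; rewrite tofrac_eq => /eqP. Qed.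

Lemma to_localization_frac y : exists a b, ~ P b /\ y * loc b = loc a.
Proof.
case: y => x hx; have /in_localizationP[a [b [nPb xE]]] := hx.
exists a, b; split=> //; apply: val_inj; rewrite /= xE divfK //.
exact: tofrac_notin_prime_neq0 nPb.
Qed.

Lemma to_localization_inv c : ~ P c -> exists y, y * loc c = 1.
Proof.
move=> nPc; have h : tofrac 1 / tofrac c \in in_localization hP.
  by apply/in_localizationP; exists 1, c.
exists (Localization h); apply: val_inj; rewrite /= divfK ?tofrac1 //.
exact: tofrac_notin_prime_neq0 nPc.
Qed.

Lemma is_ideal_localize I : is_ideal (localize_ideal hP I).
Proof. exact: is_ideal_gen. Qed.

Lemma localize_ideal_mem I a : I a -> localize_ideal hP I (loc a).
Proof. by move=> Ia; apply: sub_ideal_gen; exists a. Qed.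

(** Elements outside [P] become units of [R_P]. *)
Lemma localize_ideal_cancel I y c :
  ~ P c -> localize_ideal hP I (y * loc c) -> localize_ideal hP I y.
Proof.
move=> /to_localization_inv[w wc] Iyc.
have -> : y = w * (y * loc c) by rewrite mulrCA wc mulr1.
by have [_ _] := is_ideal_localize I; apply.
Qed.

(** Fractions with numerator in [I] are already closed under addition, by
    passing to a common denominator, so they exhaust the extension of [I]. *)
Lemma localize_idealP I y : is_ideal I ->
  localize_ideal hP I y <-> exists a c, [/\ I a, ~ P c & y * loc c = loc a].
Proof.
move=> [I0 ID IM]; split; last first.
  move=> [a [c [Ia nPc yc]]]; apply: (localize_ideal_cancel nPc).
  by rewrite yc; apply: localize_ideal_mem.
move: y; apply: ideal_gen_min; last first.
  by move=> _ [a Ia <-]; exists a, 1; rewrite rmorph1 mulr1; case: hP.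
split=> [|u v [a [c [Ia nPc uc]]] [b [d [Ib nPd vd]]]|x u [a [c [Ia nPc uc]]]].
- by exists 0, 1; rewrite rmorph0 mul0r; case: hP.
- exists (d * a + c * b), (c * d).
  split; [by apply: ID; apply: IM | exact: (notin_primeM hP) |].
  rewrite rmorphD !rmorphM /= -uc -vd mulrDl.
  by congr (_ + _); [rewrite mulrA mulrC | rewrite mulrCA].
- have [b [d [nPd xd]]] := to_localization_frac x.
  exists (b * a), (d * c); split; [exact: IM | exact: (notin_primeM hP) |].
  by rewrite !rmorphM /= -uc -xd mulrACA.
Qed.

(** The contraction of the extension of [I] is the saturation of [I] by the
    complement of [P]. *)
Lemma localize_ideal_fracP I a : is_ideal I ->
  localize_ideal hP I (loc a) <-> exists c, ~ P c /\ I (c * a).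
Proof.
move=> hI; split=> [/(localize_idealP _ hI)[b [c [Ib nPc]]]|[c [nPc Ica]]].
  rewrite -rmorphM => /to_localization_inj acb.
  by exists c; rewrite mulrC acb.
apply: (localize_ideal_cancel nPc).
by rewrite -rmorphM mulrC; apply: localize_ideal_mem.
Qed.

(** A prime [P] is its own saturation: if [c a] is in [P] and [c] is not, then
    [a] is. *)
Lemma localize_prime_contract a : localize_ideal hP P (loc a) -> P a.
Proof.
have [PI _ PM] := hP.
by case/(localize_ideal_fracP _ PI) => c [nPc /PM[]].
Qed.

Lemma prime_localize : prime_ideal (localize_ideal hP P).
Proof.
have [_ nP1 PM] := hP; split; first exact: is_ideal_localize.
  by rewrite -(rmorph1 loc) => /localize_prime_contract.
move=> u v Puv.
have [a [b [nPb ub]]] := to_localization_frac u.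
have [c [d [nPd vd]]] := to_localization_frac v.
have /localize_prime_contract/PM[Pa|Pc] : localize_ideal hP P (loc (a * c)).
- rewrite rmorphM /= -ub -vd mulrACA mulrC.
  by have [_ _] := is_ideal_localize P; apply.
- left; apply: (localize_ideal_cancel nPb).
  by rewrite ub; apply: localize_ideal_mem.
- right; apply: (localize_ideal_cancel nPd).
  by rewrite vd; apply: localize_ideal_mem.
Qed.

Lemma localize_ideal_mul I J : is_ideal I -> is_ideal J ->
  localize_ideal hP (ideal_mul I J) =
  ideal_mul (localize_ideal hP I) (localize_ideal hP J).
Proof.
move=> hI hJ; apply/seteqP; split.
  apply: ideal_gen_min; first exact: is_ideal_gen.
  set L := ideal_mul (localize_ideal hP I) (localize_ideal hP J).
  have [L0 LD LM] : is_ideal L by exact: is_ideal_gen.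
  move=> _ [x IJx <-]; move: x IJx.
  (* The preimage of an ideal under [loc] is an ideal, so it suffices to look at
     the products which generate [I J]. *)
  apply: (@ideal_gen_min _ _ (loc @^-1` L)).
    split=> [|u v|a u]; rewrite /preimage /= ?rmorph0 ?rmorphD ?rmorphM //.
      exact: LD.
    exact: LM.
  move=> x [u [v [Iu Jv xE]]]; rewrite /preimage /= xE rmorphM.
  by apply: ideal_mul_mem; apply: localize_ideal_mem.
apply: ideal_gen_min; first exact: is_ideal_localize.
move=> z [u [v [+ + ->]]].
move=> /(localize_idealP _ hI)[a [c [Ia nPc uc]]].
move=> /(localize_idealP _ hJ)[b [d [Jb nPd vd]]].
apply: (@localize_ideal_cancel _ _ (c * d)); first exact: (notin_primeM hP).
rewrite rmorphM /= mulrACA uc vd -rmorphM.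
by apply: localize_ideal_mem; apply: ideal_mul_mem.
Qed.

Lemma localize_ideal_exp I k : is_ideal I ->
  ideal_exp (localize_ideal hP I) k = localize_ideal hP (ideal_exp I k).
Proof.
move=> hI; elim: k => [|k IHk]; last first.
  by rewrite /ideal_exp !iterS -!/(ideal_exp _ _) IHk localize_ideal_mul //;
     apply: is_ideal_exp.
apply/seteqP; split=> // y _.
have [_ _ LM] := is_ideal_localize setT.
by rewrite -[y]mulr1 -(rmorph1 loc); apply: LM; apply: localize_ideal_mem.
Qed.

(** If [P = (Q : f)], the same [f] witnesses the extension: an element of
    [(Q R_P : f/1)] has a numerator [a] with [c a f] in [Q] for some [c] outside
    [P], so that [c a], and then [a], is in [P]. *)
Lemma Ass_localize Q :
  is_ideal Q -> Ass Q P -> Ass (localize_ideal hP Q) (localize_ideal hP P).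
Proof.
move=> hQ [_ [f PE]]; split; first exact: prime_localize.
have [PI _ PM] := hP.
exists (loc f); apply/seteqP; split.
  apply: ideal_gen_min; first exact/is_ideal_colon/is_ideal_localize.
  move=> _ [a Pa <-]; rewrite /colon /= -rmorphM.
  by apply: localize_ideal_mem; move: Pa; rewrite {1}PE.
move=> y; rewrite /colon /= => Qyf.
have [a [b [nPb yb]]] := to_localization_frac y.
apply: (localize_ideal_cancel nPb); rewrite yb; apply: localize_ideal_mem.
have : localize_ideal hP Q (loc (a * f)).
  rewrite rmorphM /= -yb mulrAC mulrC.
  by have [_ _] := is_ideal_localize Q; apply.
case/(localize_ideal_fracP _ hQ) => c [nPc Qcaf].
have /PM[//|//] : P (c * a) by rewrite PE /colon /= -mulrA.
Qed.

(** A witness [f/b] for [P R_P] shows only that each [a f] with [a] in [P] is in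
    the saturation of [Q]. Multiplying [f] by one denominator [c] common to the
    generators brings all these products into [Q], and gives no colon ideal larger
    than [P], because [c] is a unit of [R_P]. *)
Lemma Ass_delocalize Q (s : seq R) :
    is_ideal Q -> P = ideal_gen [set` s] ->
    Ass (localize_ideal hP Q) (localize_ideal hP P) ->
  Ass Q P.
Proof.
move=> hQ Ps [_ [x PxE]]; split=> //.
have [_ _ LQM] := is_ideal_localize Q.
have [f [b [nPb xb]]] := to_localization_frac x.
(* [P] is the contraction of [(Q R_P : x)], and [x] and [f/1] are associates
   in [R_P]. *)
have PxP a : P a <-> localize_ideal hP Q (loc (a * f)).
  have -> : loc (a * f) = loc a * x * loc b by rewrite rmorphM /= -xb mulrA.
  split=> [Pa|/(localize_ideal_cancel nPb) Qax].
    rewrite mulrC; apply: LQM; have := localize_ideal_mem Pa.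
    by rewrite PxE.
  by apply: localize_prime_contract; rewrite PxE.
have [a sa|c [nPc Qc]] := @common_denominator _ P (colon Q f) s hP
  (is_ideal_colon f hQ).
  have /PxP/(localize_ideal_fracP _ hQ)[c [nPc Qcaf]] : P a.
    by rewrite Ps; apply: sub_ideal_gen.
  by exists c; rewrite /colon /= -mulrA.
exists (c * f); apply/seteqP; split.
  rewrite {1}Ps; apply: ideal_gen_min; first exact: is_ideal_colon.
  by move=> a sa; have := Qc a sa; rewrite /colon /= mulrCA mulrA.
move=> a; rewrite /colon /= => Qacf.
apply/PxP/(localize_ideal_fracP _ hQ); exists c.
by rewrite mulrCA.
Qed.

End Localization.

(** * Ideals of variables *)

Lemma ideal_of_vars_fingen (K : fieldType) (n : nat) (V : set 'I_n) :
  exists s : seq {mpoly K[n]}, ideal_of_vars V = ideal_gen [set` s].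
Proof.
exists [seq 'X_i | i <- enum 'I_n & `[< V i >]].
rewrite /ideal_of_vars; congr ideal_gen; apply/seteqP; split=> x /=.
  move=> [i Vi <-]; apply/mapP; exists i => //.
  by rewrite mem_filter mem_enum andbT; apply/asboolP.
by move=> /mapP[i]; rewrite mem_filter => /andP[/asboolP Vi _] ->; exists i.
Qed.

Lemma ideal_of_varsS (K : fieldType) (n : nat) (V W : set 'I_n) :
  V `<=` W -> ideal_of_vars V `<=` (ideal_of_vars W : set {mpoly K[n]}).
Proof.
move=> VW; apply: ideal_gen_min; first exact: is_ideal_gen.
by move=> _ [i Vi <-]; apply: sub_ideal_gen; exists i => //; apply: VW.
Qed.

(** * Localizing at the extra associated prime *)

Theorem theorem4p2 (K : fieldType) (n : nat) (I : set {mpoly K[n]})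
    (p : set {mpoly K[n]}) (m : nat) :
  nearly_normally_torsion_free I ->
  supp I = setT ->
  monomial_prime_ideal p ->
  ~ Min I p ->
  (1 <= m)%N ->
  (forall t : nat, (1 <= t <= m)%N -> Ass (ideal_exp I t) = Min I) ->
  (forall t : nat, (m + 1 <= t)%N ->
     Ass (ideal_exp I t) `<=` Min I `|` [set p]) ->
  (forall (P : set {mpoly K[n]}) (hP : monomial_prime_ideal P),
     P `<` ideal_of_vars (supp I) -> ~ Min I P ->
     normally_torsion_free
       (localize_ideal (monomial_prime_ideal_prime hP) I)) ->
  (exists2 s : nat, (m + 1 <= s)%N & Ass (ideal_exp I s) p) ->
  p = ideal_of_vars (supp I).
Proof.
move=> [[G IG] _] suppT pmon npMin m1 AssMin _ ntf [s sm Assp].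
have hI : is_ideal I by rewrite IG; apply: is_ideal_gen.
have [V pV] := pmon; have [gens pgens] := ideal_of_vars_fingen K V.
have psub : p `<=` ideal_of_vars (supp I).
  by rewrite pV suppT; apply: ideal_of_varsS.
apply: contrapT => pNm.
have pproper : p `<` ideal_of_vars (supp I).
  by split=> // mp; apply: pNm; apply/seteqP.
have := ntf p pmon pproper npMin s (leq_trans (leq_addl m 1) sm).
set hP := monomial_prime_ideal_prime pmon => ntfs.
apply: npMin; rewrite -(AssMin 1%N m1) ideal_exp1 //.
apply: (Ass_delocalize (hP := hP) hI (s := gens)); first by rewrite -pgens.
apply: ntfs; rewrite localize_ideal_exp //.
by apply: Ass_localize => //; apply: is_ideal_exp.
Qed.
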